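(* Consider the control system $\dot x=f(x)+g(x)u$ with $f,g$ locally Lipschitz, $x\in\mathbb{R}^n$, $u\in U=\mathbb{R}^m$. Let $\mathcal{C}\subset\mathbb{R}^n$ be a set such that $\mathcal{C}=\{x:h(x)\ge0\}$, $\partial\mathcal{C}=\{x:h(x)=0\}$, $\mathrm{Int}(\mathcal{C})=\{x:h(x)>0\}$ for a function $h:\mathbb{R}^n\to\mathbb{R}$ with relative degree $r\ge2$, i.e. $h$ is $r$-times continuously differentiable and for all $x\in\mathrm{Int}(\mathcal{C})$, $L_gL_f^kh(x)=0$ for $0\le k\le r-2$ and $L_gL_f^{r-1}h(x)\ne0$. Then for any constant $H_{\max}>0$ and any continuously differentiable function $H:\mathbb{R}\to[0,\infty)$ satisfying (i) $0\le H(\lambda)\le H_{\max}$ for all $\lambda\in\mathbb{R}$, and (ii) $\frac{dH(\lambda)}{d\lambda}\ne0$ for all $\lambda\in\mathbb{R}$, the function $B_r:\mathrm{Int}(\mathcal{C})\to[0,\infty)$ defined by $$B_r=\frac1h+H\circ L_f^{r-1}h$$ is a reciprocal control barrier function for $\mathcal{C}$.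
   Context: $\mathrm{Int}(\mathcal{C})$, $\partial\mathcal{C}$ denote interior and boundary. For a differentiable function $W$, $L_fW(x)=\frac{\partial W}{\partial x}(x)f(x)$, $L_gW(x)=\frac{\partial W}{\partial x}(x)g(x)$; $L_f^0h=h$, $L_f^{k}h=L_f(L_f^{k-1}h)$. The functions $f$ and $h$ are understood to be smooth enough that $L_f^kh$, $0\le k\le r-1$, are well-defined continuously differentiable functions. Class $\mathcal{K}$: continuous strictly increasing functions $\beta:[0,a)\to[0,\infty)$, $a>0$ (possibly $\infty$), with $\beta(0)=0$; arguments are understood to lie in the domain. Reciprocal control barrier function (RCBF) for $\mathcal{C}$ with input set $U$: a continuously differentiable $B:\mathrm{Int}(\mathcal{C})\to\mathbb{R}$ for which there are class $\mathcal{K}$ functions $\alpha_1,\alpha_2,\alpha_3$ such that for all $x\in\mathrm{Int}(\mathcal{C})$, $$\frac1{\alpha_1(h(x))}\le B(x)\le\frac1{\alpha_2(h(x))},\qquad \inf_{u\in U}[L_fB(x)+L_gB(x)u-\alpha_3(h(x))]\le0.$$ *)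

(* Defs.v *)
From HB Require Import structures.
From mathcomp Require Import all_boot all_order all_algebra.
From mathcomp Require Import all_classical all_reals all_analysis.
Import Order.TTheory GRing.Theory Num.Theory.
Import numFieldNormedType.Exports.

Set Implicit Arguments.
Unset Strict Implicit.
Unset Printing Implicit Defensive.

Local Open Scope classical_set_scope.
Local Open Scope ring_scope.

(* Points of R^n are column vectors 'cV[R]_n.
   A function given only on Int(C) is represented by a total function whose
   values outside Int(C) are irrelevant. *)

Definition boundary (T : topologicalType) (A : set T) : set T :=
  closure A `\` interior A.

Definition partial (R : realType) (n : nat) (j : 'I_n) (W : 'cV[R]_n -> R) :
    'cV[R]_n -> R :=
  fun x => 'D_(delta_mx j 0) W x.

Definition gradient (R : realType) (n : nat) (W : 'cV[R]_n -> R)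
    (x : 'cV[R]_n) : 'rV[R]_n :=
  \row_j partial j W x.

(* k-times continuous differentiability on D; only meant for open D, since
   continuity and differentiability are taken in the full space. *)
Fixpoint cont_diff (R : realType) (n : nat) (D : set 'cV[R]_n) (k : nat)
    (W : 'cV[R]_n -> R) : Prop :=
  match k with
  | 0 => forall x, D x -> {for x, continuous W}
  | k'.+1 => (forall x, D x -> differentiable W x) /\
             (forall j : 'I_n, cont_diff D k' (partial j W))
  end.

Definition lie_f (R : realType) (n : nat) (f : 'cV[R]_n -> 'cV[R]_n)
    (W : 'cV[R]_n -> R) : 'cV[R]_n -> R :=
  fun x => (gradient W x *m f x) 0 0.

Definition lie_g (R : realType) (n m : nat) (g : 'cV[R]_n -> 'M[R]_(n, m))
    (W : 'cV[R]_n -> R) : 'cV[R]_n -> 'rV[R]_m :=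
  fun x => gradient W x *m g x.

Definition lie_f_iter (R : realType) (n : nat) (f : 'cV[R]_n -> 'cV[R]_n)
    (k : nat) (W : 'cV[R]_n -> R) : 'cV[R]_n -> R :=
  iter k (lie_f f) W.

(* For r >= 2, k.+1 < r is the range 0 <= k <= r - 2. *)
Definition relative_degree (R : realType) (n m : nat)
    (f : 'cV[R]_n -> 'cV[R]_n) (g : 'cV[R]_n -> 'M[R]_(n, m))
    (D : set 'cV[R]_n) (h : 'cV[R]_n -> R) (r : nat) : Prop :=
  cont_diff setT r h /\
  forall x, D x ->
    (forall k, (k.+1 < r)%N -> lie_g g (lie_f_iter f k h) x = 0) /\
    lie_g g (lie_f_iter f r.-1 h) x <> 0.

(* [0, a), with a possibly +oo *)
Definition classK_dom (R : realType) (a : \bar R) : set R :=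
  [set s | 0 <= s /\ (s%:E < a)%E].

Definition classK (R : realType) (a : \bar R) (beta : R -> R) : Prop :=
  [/\ (0 < a)%E,
      {within classK_dom a, continuous beta},
      forall s t, classK_dom a s -> classK_dom a t -> s < t -> beta s < beta t,
      forall s, classK_dom a s -> 0 <= beta s
    & beta 0 = 0].

(* The infimum is taken in \bar R: it is -oo when unbounded below. *)
Definition RCBF (R : realType) (n m : nat)
    (f : 'cV[R]_n -> 'cV[R]_n) (g : 'cV[R]_n -> 'M[R]_(n, m))
    (U : set 'cV[R]_m) (C : set 'cV[R]_n) (h : 'cV[R]_n -> R)
    (B : 'cV[R]_n -> R) : Prop :=
  cont_diff (interior C) 1 B /\
  exists (a1 a2 a3 : \bar R) (alpha1 alpha2 alpha3 : R -> R),
    [/\ classK a1 alpha1, classK a2 alpha2, classK a3 alpha3 &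
      forall x, interior C x ->
        [/\ classK_dom a1 (h x), classK_dom a2 (h x), classK_dom a3 (h x),
            (alpha1 (h x))^-1 <= B x <= (alpha2 (h x))^-1 &
            (ereal_inf
               [set (lie_f f B x + (lie_g g B x *m u) 0 0 - alpha3 (h x))%:E
               | u in U] <= 0)%E]].

(* Main.v *)
(* Since 0 <= H <= Hmax, B_r is squeezed between 1/h and (1 + Hmax h)/h, which
   gives alpha1(s) = s and alpha2(s) = s/(1 + Hmax s). As r >= 2, L_g h = 0, so
   L_g B_r = H'(L_f^{r-1} h) L_g L_f^{r-1} h never vanishes; as U is the whole
   space, u can cancel all the other terms, whatever alpha3 is. *)
Require Import Defs.
From HB Require Import structures.
From mathcomp Require Import all_boot all_order all_algebra.
From mathcomp Require Import all_classical all_reals all_analysis.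
From mathcomp Require Import lra.
Import Order.TTheory GRing.Theory Num.Theory.
Import numFieldNormedType.Exports.

Set Implicit Arguments.
Unset Strict Implicit.
Unset Printing Implicit Defensive.

Local Open Scope classical_set_scope.
Local Open Scope ring_scope.

Lemma derive_comp1 (R : realType) (V : normedModType R) (phi : R -> R)
    (W : V -> R) (x v : V) :
  differentiable W x -> derivable phi (W x) 1 ->
  'D_v (phi \o W) x = derive1 phi (W x) * 'D_v W x.
Proof.
move=> dW /derivable1_diffP dphi.
rewrite deriveE; last exact: differentiable_comp.
rewrite diff_comp //= derive1E !deriveE //.
(* The differential of [phi] is linear on the line, so its value at a number is that number times
   its value at 1, which is the derivative. *)
have /(congr1 ('d phi (W x))) <- : 'd W x v *: (1 : R) = 'd W x v by exact: mulr1.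
by rewrite linearZ mulrC.
Qed.

Lemma cont_diff_continuous (R : realType) (n : nat) (D : set 'cV[R]_n)
    (W : 'cV[R]_n -> R) (x : 'cV[R]_n) :
  cont_diff D 1 W -> D x -> {for x, continuous W}.
Proof. by move=> [dW _] Dx; apply: differentiable_continuous; exact: dW. Qed.

Lemma derivable_inv (R : realType) (s : R) :
  s != 0 -> derivable (fun t : R => t^-1) s 1.
Proof. by move=> s0; exact: derivableV. Qed.

Lemma derive1_inv (R : realType) (s : R) :
  s != 0 -> derive1 (fun t : R => t^-1) s = - s ^- 2.
Proof.
move=> s0; rewrite derive1E (deriveV (f := id))//.
by rewrite derive_id -[_ *: _]/(_ * _) mulr1.
Qed.

Lemma continuous_derive1_inv (R : realType) (s : R) :
  0 < s -> {for s, continuous (derive1 (fun t : R => t^-1))}.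
Proof.
move=> s0; rewrite /prop_for /continuous_at derive1_inv ?gt_eqF//.
(* The formula for the derivative is available only away from 0, so it is substituted near [s],
   where all points are positive. *)
apply: (cvg_trans (G := (fun t : R => - t ^- 2) @ s)).
  apply: (near_eq_cvg (F := nbhs s)); near=> t.
  have t0 : 0 < t by near: t; exact: lt_nbhsr.
  by rewrite derive1_inv ?gt_eqF.
apply: (@continuousN _ _ _ (fun t : R => t ^- 2)).
apply: (@continuousV _ _ (fun t : R => t ^+ 2)); last exact: exprn_continuous.
by rewrite expf_neq0 ?gt_eqF.
Unshelve. all: by end_near. Qed.

Lemma classK_id (R : realType) : classK +oo%E (@id R).
Proof.
split=> //; last by move=> s [].
by apply: continuous_subspaceT => s; exact: cvg_id.
Qed.

Lemma classK_dom_pinfty (R : realType) (s : R) : 0 <= s -> classK_dom +oo%E s.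
Proof. by move=> s0; split=> //; exact: ltry. Qed.

(** For [s > 0] this function is the reciprocal of [1 / s + M], the upper bound wanted for [B_r]. *)
Lemma classK_inv_addr (R : realType) (M : R) :
  0 < M -> classK +oo%E (fun s => s / (1 + M * s)).
Proof.
move=> M0.
have den_gt0 s : 0 <= s -> 0 < 1 + M * s.
  by move=> s0; rewrite ltr_pwDl// mulr_ge0// ltW.
split; rewrite ?mul0r//.
- apply: continuous_in_subspaceT => s /set_mem[s0 _].
  apply: cvgM; first exact: cvg_id.
  apply: cvgV; first by rewrite gt_eqF// den_gt0.
  by apply: cvgD; [exact: cvg_cst|apply: cvgM; [exact: cvg_cst|exact: cvg_id]].
- move=> s t [s0 _] [t0 _] st.
  (* Cross-multiplied, the goal is [s * (1 + M * t) < t * (1 + M * s)]; the terms in [M * s * t]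
     cancel and leave [s < t]. *)
  rewrite ltr_pdivrMr ?den_gt0// mulrAC ltr_pdivlMr ?den_gt0//; nra.
- by move=> s [s0 _]; rewrite divr_ge0// ltW// den_gt0.
Qed.

Section SumOfComposites.
Variables (R : realType) (n : nat) (D : set 'cV[R]_n).
Variables (phi psi : R -> R) (V W : 'cV[R]_n -> R).
Hypotheses (dV : cont_diff D 1 V) (dW : cont_diff D 1 W).
Hypothesis dphi : forall x, D x -> derivable phi (V x) 1.
Hypothesis dpsi : forall x, D x -> derivable psi (W x) 1.

Let B x := phi (V x) + psi (W x).

(** The chain rule in each coordinate. It serves with [phi] the inverse, [V] the function [h], [psi]
    the function [H] and [W] the last Lie derivative; [phi] is differentiated only at values of [V]
    on [D], which keeps the inverse away from 0. *)
Lemma gradient_add_comp x : D x ->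
  gradient B x = derive1 phi (V x) *: gradient V x
                 + derive1 psi (W x) *: gradient W x.
Proof.
move=> Dx; have dVx := dV.1 x Dx; have dWx := dW.1 x Dx.
have phiV : differentiable (phi \o V) x.
  by apply: differentiable_comp => //; apply/derivable1_diffP/dphi.
have psiW : differentiable (psi \o W) x.
  by apply: differentiable_comp => //; apply/derivable1_diffP/dpsi.
apply/rowP => j; rewrite !mxE /partial.
rewrite -(derive_comp1 _ dVx (dphi Dx)) -(derive_comp1 _ dWx (dpsi Dx)).
by rewrite -deriveD//; exact: diff_derivable.
Qed.

Hypothesis oD : open D.
Hypothesis cphi : forall x, D x -> {for V x, continuous (derive1 phi)}.
Hypothesis cpsi : forall x, D x -> {for W x, continuous (derive1 psi)}.

(** The gradient formula is known only on [D]; as [D] is open, it holds near each of its points, so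
    continuity passes from the formula to the partial derivatives. *)
Lemma cont_diff_add_comp : cont_diff D 1 B.
Proof.
split=> [x Dx|j x Dx].
  apply: differentiableD; apply: differentiable_comp; [exact: dV.1| |exact: dW.1|].
    exact/derivable1_diffP/dphi.
  exact/derivable1_diffP/dpsi.
have pE y : D y -> partial j B y = derive1 phi (V y) * partial j V y
                                   + derive1 psi (W y) * partial j W y.
  by move=> /gradient_add_comp/rowP/(_ j); rewrite !mxE.
rewrite /prop_for /continuous_at pE//.
apply: (cvg_trans (G := (fun y => derive1 phi (V y) * partial j V y
                       + derive1 psi (W y) * partial j W y) @ x)).
  apply: (near_eq_cvg (F := nbhs x)); near=> y.
  by rewrite pE//; near: y; exact: open_nbhs_nbhs.
have cprod (phi' : R -> R) (V' : 'cV[R]_n -> R) :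
    cont_diff D 1 V' -> {for V' x, continuous (derive1 phi')} ->
    (fun y => derive1 phi' (V' y) * partial j V' y) @ x -->
    derive1 phi' (V' x) * partial j V' x.
  move=> dV' cphi'.
  apply: (@cvgM _ _ (nbhs x) _ (derive1 phi' \o V')); last exact: dV'.2.
  exact: continuous_comp (cont_diff_continuous dV' Dx) cphi'.
by apply: (@cvgD _ _ _ (nbhs x)); apply: cprod => //; [exact: cphi|exact: cpsi].
Unshelve. all: by end_near. Qed.

End SumOfComposites.

Lemma ereal_inf_affine (R : realType) (m : nat) (a : R) (v : 'rV[R]_m) :
  v != 0 ->
  (ereal_inf [set (a + (v *m u) 0 0)%:E | u in [set: 'cV[R]_m]] <= 0)%E.
Proof.
move=> /rV0Pn[j vj0]; apply: ereal_inf_lbound.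
(* Acting through the single coordinate [j], where [v] is nonzero, this input makes the affine
   expression exactly 0. *)
exists (- (a / v 0 j) *: delta_mx j 0) => //.
by rewrite -scalemxAr -colE !mxE mulNr divfK// subrr.
Qed.

Theorem proposition4 (R : realType) (n m : nat)
    (f : 'cV[R]_n -> 'cV[R]_n) (g : 'cV[R]_n -> 'M[R]_(n, m))
    (f_lip : [locally [lipschitz f x | x in setT]])
    (g_lip : [locally [lipschitz g x | x in setT]])
    (C : set 'cV[R]_n) (h : 'cV[R]_n -> R)
    (C_def : C = [set x | 0 <= h x])
    (C_boundary : boundary C = [set x | h x = 0])
    (C_interior : interior C = [set x | 0 < h x])
    (r : nat) (r_ge2 : (2 <= r)%N)
    (h_reldeg : relative_degree f g (interior C) h r)
    (h_smooth : forall k, (k <= r.-1)%N ->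
       cont_diff setT 1 (lie_f_iter f k h))
    (Hmax : R) (Hmax_gt0 : 0 < Hmax)
    (H : R -> R)
    (H_derivable : forall l, derivable H l 1)
    (H_derive_cont : continuous (derive1 H))
    (H_bounds : forall l, 0 <= H l <= Hmax)
    (H_derive_neq0 : forall l, derive1 H l <> 0) :
  let B_r := fun x => (h x)^-1 + H (lie_f_iter f r.-1 h x) in
  (forall x, interior C x -> 0 <= B_r x) /\
  RCBF f g setT C h B_r.

Proof.
move=> B_r; set W := lie_f_iter f r.-1 h in B_r *.
have hgt0 x : interior C x -> 0 < h x by rewrite C_interior.
have B_ge0 x : interior C x -> 0 <= B_r x.
  move=> /hgt0 hx; rewrite addr_ge0 ?invr_ge0 ?(ltW hx)//.
  by have /andP[] := H_bounds (W x).
have toInt F : cont_diff setT 1 F -> cont_diff (interior C) 1 F.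
  by move=> [dF pF]; split=> [x _|j x _]; [exact: dF|exact: pF].
have dh := toInt _ (h_smooth 0 (leq0n _)).
have dW := toInt _ (h_smooth _ (leqnn _)).
have dinv x : interior C x -> derivable (fun t : R => t^-1) (h x) 1.
  by move=> /hgt0/lt0r_neq0; exact: derivable_inv.
have dH x : interior C x -> derivable H (W x) 1 by [].
have gB := gradient_add_comp dh dW dinv dH.
split=> //; split.
  apply: (cont_diff_add_comp dh dW dinv dH) => [|x /hgt0 hx|x _].
  - exact: open_interior.
  - exact: continuous_derive1_inv.
  - exact: H_derive_cont.
exists +oo%E, +oo%E, +oo%E, id, (fun s => s / (1 + Hmax * s)), id.
split; [exact: classK_id|exact: classK_inv_addr|exact: classK_id|].
move=> x Cx; have hx := hgt0 _ Cx; have hdom := classK_dom_pinfty (ltW hx).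
have /andP[H0 HM] := H_bounds (W x).
split=> //.
  (* The lower bound is [0 <= H (W x)]. For the upper one, the inverse of [alpha2 (h x)] expands to
     [(h x)^-1 + Hmax], which leaves [H (W x) <= Hmax]. *)
  rewrite lerDl H0 invf_div mulrDl mul1r mulfK ?gt_eqF// lerD2l.
  exact: HM.
have [lgk lgr] := h_reldeg.2 _ Cx.
have gBg : lie_g g B_r x = derive1 H (W x) *: lie_g g W x.
  rewrite /lie_g gB// mulmxDl -!scalemxAl.
  (* The case [k = 0] of the relative degree condition, admissible because [r >= 2]. *)
  by have -> : gradient h x *m g x = 0; [exact: (lgk 0)|rewrite scaler0 add0r].
(* Regrouping puts the terms free of [u] together as the constant of an affine function of [u]. *)
under eq_imagel => u _ do rewrite addrAC.
apply: ereal_inf_affine; rewrite gBg scaler_eq0 negb_or.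
by apply/andP; split; apply/eqP => //; exact: H_derive_neq0.
Qed.
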